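(* The homomorphisms of seed tori $$p_{\mathbf i}:\mathcal A_{\mathbf i}\longrightarrow\mathcal X_{\mathbf i},\qquad p_{\mathbf i}^*X_i=\prod_{j\in I}A_j^{\varepsilon_{ij}},$$ defined for all seeds $\mathbf i$ equivalent to a given seed, give rise to a map of positive spaces $p:\mathcal A\to\mathcal X$; that is, for every seed cluster transformation $\mathbf c:\mathbf i\to\mathbf i'$ with induced birational isomorphisms $\mathbf c^a:\mathcal A_{\mathbf i}\to\mathcal A_{\mathbf i'}$ and $\mathbf c^x:\mathcal X_{\mathbf i}\to\mathcal X_{\mathbf i'}$ one has $p_{\mathbf i'}\circ\mathbf c^a=\mathbf c^x\circ p_{\mathbf i}$.
   Context: A seed $\mathbf i=(I,I_0,\varepsilon,d)$ consists of a finite set $I$, a subset $I_0\subset I$ of frozen elements, a $\mathbb Q$-valued function $\varepsilon=(\varepsilon_{ij})$ on $I\times I$ with $\varepsilon_{ij}\in\mathbb Z$ unless $(i,j)\in I_0\times I_0$, and positive integers $\{d_i\}_{i\in I}$ with greatest common divisor $1$ such that $\varepsilon_{ij}d_j^{-1}$ is skew-symmetric. For $k\in I\setminus I_0$ the mutated seed $\mu_k(\mathbf i)=(I,I_0,\varepsilon',d)$ is given by $\varepsilon'_{ij}=-\varepsilon_{ij}$ if $k\in\{i,j\}$; $\varepsilon'_{ij}=\varepsilon_{ij}$ if $k\notin\{i,j\}$ and $\varepsilon_{ik}\varepsilon_{kj}\le 0$; $\varepsilon'_{ij}=\varepsilon_{ij}+|\varepsilon_{ik}|\varepsilon_{kj}$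 if $k\notin\{i,j\}$ and $\varepsilon_{ik}\varepsilon_{kj}>0$. $\mathcal X_{\mathbf i}$ and $\mathcal A_{\mathbf i}$ are split algebraic tori with coordinates $\{X_i\}_{i\in I}$ and $\{A_i\}_{i\in I}$. The mutation induces birational maps (with $X'_i,A'_i$ the coordinates for $\mu_k(\mathbf i)$) $$\mu_k^*X'_k=X_k^{-1},\qquad \mu_k^*X'_i=X_i(1+X_k^{-\mathrm{sgn}(\varepsilon_{ik})})^{-\varepsilon_{ik}}\ (i\ne k),$$ $$A_k\cdot\mu_k^*A'_k=\prod_{j:\varepsilon_{kj}>0}A_j^{\varepsilon_{kj}}+\prod_{j:\varepsilon_{kj}<0}A_j^{-\varepsilon_{kj}},\qquad \mu_k^*A'_i=A_i\ (i\neq k),$$ empty products being $1$. A seed isomorphism $\sigma$ (a bijection of index sets preserving frozen elements, $\varepsilon$, $d$) induces $\sigma^*X'_{\sigma(i)}=X_i$, $\sigma^*A'_{\sigma(i)}=A_i$. A seed cluster transformation is a composition of mutations and seed isomorphisms; $\mathbf c^a,\mathbf c^x$ are the corresponding compositions of birational maps. Seeds related by a cluster transformation are called equivalent. The positive spaces $\mathcal A$ and $\mathcal X$ are the functors from the groupoid of seeds equivalent to a given one (morphisms: cluster transformations modulo those acting trivially on both kinds of tori) to the category of split tori and positive rational maps, sending $\mathbf i$ to $\mathcal A_{\mathbf i}$, resp. $\mathcal X_{\mathbf i}$, and $\mathbf c$ to $\mathbf c^a$, resp. $\mathbf c^x$. A map of positive spaces with common coordinate groupoid (lying over the identity functor)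 is a natural transformation.
   Formalization: If some ε_ij with i, j both frozen is not an integer, p_i is not a homomorphism of tori; the claim is stated literally for seeds with all ε_ij integral, and for other seeds as the same commutation with fractional powers read as positive roots. *)

(* Defs.v *)
From HB Require Import structures.
From mathcomp Require Import all_boot all_order all_algebra.
From mathcomp.multinomials Require Import mpoly.

Set Implicit Arguments.
Unset Strict Implicit.
Unset Printing Implicit Defensive.

Import Order.TTheory GRing.Theory Num.Theory.
Local Open Scope ring_scope.

(* A split torus with coordinates indexed by a finite type I has the field of
   rational functions [ratfun I], the fraction field of Z[x_i, i in I].  A
   rational function is positive when it is a quotient of nonzero polynomials
   with non-negative integral coefficients.  Allowing Laurent monomials
   (characters) instead of monomials gives the same functions, since
   denominators can be cleared. *)

Definition ratfun (I : finType) := {fraction {mpoly int[#|I|]}}.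

Definition coord (I : finType) (i : I) : ratfun I :=
  FracField.tofrac ('X_(enum_rank i) : {mpoly int[#|I|]}).

Definition pos_poly (n : nat) (P : {mpoly int[n]}) : bool :=
  (P != 0) && all (fun m => 0 <= P@_m) (msupp P).

Definition pos_quot (I : finType) (f : ratfun I)
    (PQ : {mpoly int[#|I|]} * {mpoly int[#|I|]}) : bool :=
  [&& pos_poly PQ.1, pos_poly PQ.2 &
      f == FracField.tofrac PQ.1 / FracField.tofrac PQ.2].

Definition positive (I : finType) (f : ratfun I) : Prop :=
  exists PQ, pos_quot f PQ.

Record posfun (I : finType) := PosFun {
  posval :> ratfun I;
  posvalP : positive posval
}.

(* A positive rational map from the torus with coordinates I to the torus with
   coordinates J is given by the pullbacks of the coordinates of the target;
   it need not be dominant. *)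
Definition posmap (I J : finType) := J -> posfun I.

Definition posmap_eq (I J : finType) (f g : posmap I J) : Prop :=
  forall j, posval (f j) = posval (g j).

Notation "f =pm g" := (posmap_eq f g) (at level 70, no associativity).

Definition eval_poly_at (I J : finType) (f : posmap I J)
    (P : {mpoly int[#|J|]}) : ratfun I :=
  mmap (fun z : int => z%:~R) (fun r => posval (f (enum_val r))) P.

Lemma pos_polyE n (P : {mpoly int[n]}) :
  pos_poly P <-> P != 0 /\ forall m, 0 <= P@_m.
Proof.
split.
- case/andP=> P0 /allP h; split=> // m.
  by case: (boolP (m \in msupp P)) => [/h //|/memN_msupp_eq0 ->].
- by case=> P0 h; rewrite /pos_poly P0; apply/allP=> m _; apply: h.
Qed.

Lemma pos_polyM n (P Q : {mpoly int[n]}) :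
  pos_poly P -> pos_poly Q -> pos_poly (P * Q).
Proof.
move=> /pos_polyE[P0 hP] /pos_polyE[Q0 hQ]; apply/pos_polyE.
split=> [|m]; first by rewrite mulf_neq0.
by rewrite mcoeffM; apply: sumr_ge0 => k _; apply: mulr_ge0.
Qed.

Lemma pos_polyD n (P Q : {mpoly int[n]}) :
  pos_poly P -> pos_poly Q -> pos_poly (P + Q).
Proof.
move=> /pos_polyE[P0 hP] /pos_polyE[Q0 hQ]; apply/pos_polyE.
split=> [|m]; last by rewrite mcoeffD addr_ge0.
apply: contraNneq P0 => PQ0; apply/eqP/mpolyP=> m.
have /eqP : (P + Q)@_m = 0 by rewrite PQ0 mcoeff0.
by rewrite mcoeffD mcoeff0 paddr_eq0 // => /andP[/eqP].
Qed.

Lemma pos_poly1 n : pos_poly (1 : {mpoly int[n]}).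
Proof.
apply/pos_polyE; split=> [|m]; first exact: oner_neq0.
by rewrite mcoeff1; case: (_ == _).
Qed.

Lemma pos_polyX n (i : 'I_n) : pos_poly ('X_i : {mpoly int[n]}).
Proof.
apply/pos_polyE; split=> [|m]; last by rewrite mcoeffX; case: (_ == _).
apply/eqP=> /(congr1 (mcoeff U_(i)%MM)); rewrite mcoeffX mcoeff0 eqxx.
by move/eqP; rewrite oner_eq0.
Qed.

Section PositiveFractions.
Variable I : finType.
Implicit Types f g : ratfun I.

Lemma positive_quot P Q : pos_poly P -> pos_poly Q ->
  positive (FracField.tofrac P / FracField.tofrac Q : ratfun I).
Proof. by move=> hP hQ; exists (P, Q); rewrite /pos_quot hP hQ /=. Qed.

Lemma positive_poly P : pos_poly P -> positive (FracField.tofrac P : ratfun I).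
Proof.
move=> hP; have := positive_quot hP (pos_poly1 _).
by rewrite tofrac1 divr1.
Qed.

Lemma positive_neq0 f : positive f -> f != 0.
Proof.
case=> -[P Q] /and3P[/= /andP[P0 _] /andP[Q0 _] /eqP->].
by rewrite mulf_neq0 ?invr_eq0 ?tofrac_eq0.
Qed.

Lemma positive1 : positive (1 : ratfun I).
Proof. by rewrite -tofrac1; apply: positive_poly; apply: pos_poly1. Qed.

Lemma positive_coord (i : I) : positive (coord i).
Proof. exact: (positive_poly (pos_polyX _)). Qed.

Lemma positiveD f g : positive f -> positive g -> positive (f + g).
Proof.
case=> -[P Q] /and3P[/= hP hQ /eqP->] [[R S] /and3P[/= hR hS /eqP->]].
have Q0 : FracField.tofrac Q != 0 by rewrite tofrac_eq0; case/andP: hQ.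
have S0 : FracField.tofrac S != 0 by rewrite tofrac_eq0; case/andP: hS.
rewrite (addf_div _ _ Q0 S0) -(tofracM P S) -(tofracM R Q) -(tofracM Q S).
rewrite -(tofracD (P * S) (R * Q)).
exact: positive_quot (pos_polyD (pos_polyM hP hS) (pos_polyM hR hQ))
  (pos_polyM hQ hS).
Qed.

Lemma positiveM f g : positive f -> positive g -> positive (f * g).
Proof.
case=> -[P Q] /and3P[/= hP hQ /eqP->] [[R S] /and3P[/= hR hS /eqP->]].
rewrite mulf_div -(tofracM P R) -(tofracM Q S).
exact: positive_quot (pos_polyM hP hR) (pos_polyM hQ hS).
Qed.

Lemma positiveV f : positive f -> positive f^-1.
Proof.
case=> -[P Q] /and3P[/= hP hQ /eqP->].
by rewrite invf_div; apply: positive_quot.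
Qed.

Lemma positiveXn f n : positive f -> positive (f ^+ n).
Proof.
move=> hf; elim: n => [|n IHn]; first exact: positive1.
by rewrite exprS; apply: positiveM.
Qed.

Lemma positiveXz f (z : int) : positive f -> positive (f ^ z).
Proof.
move=> hf; case: z => n; first exact: positiveXn.
by apply: positiveV; apply: positiveXn.
Qed.

Lemma positive_nat n : positive (1 *+ n.+1 : ratfun I).
Proof.
elim: n => [|n IHn]; first exact: positive1.
rewrite mulrS; exact: (positiveD positive1 IHn).
Qed.

Lemma positive_prod (J : Type) (r : seq J) (P : pred J) (F : J -> ratfun I) :
  (forall j, positive (F j)) -> positive (\prod_(j <- r | P j) F j).
Proof.
move=> hF; apply: (big_ind (@positive I)); first exact: positive1.
- by move=> f g; apply: positiveM.
- by move=> j _; apply: hF.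
Qed.

End PositiveFractions.

Lemma positive_eval (I J : finType) (f : posmap I J) P :
  pos_poly P -> positive (eval_poly_at f P).
Proof.
move=> /andP[P0 /allP hP]; rewrite /eval_poly_at /mmap.
have : (0 < size (msupp P))%N.
  by rewrite lt0n size_eq0 msupp_eq0.
have : {in msupp P, forall m, 0 < P@_m}.
  by move=> m hm; rewrite lt_neqAle hP // eq_sym -mcoeff_msupp hm.
have hm1 m : positive (mmap1 (fun r => posval (f (enum_val r))) m).
  by apply: positive_prod => r; apply: positiveXn; apply: posvalP.
have hterm m : 0 < P@_m ->
  positive ((P@_m)%:~R * mmap1 (fun r => posval (f (enum_val r))) m).
  move=> hm; apply: positiveM => //.
  by case: (P@_m) hm => [[|n]|n] // _; apply: positive_nat.
elim: (msupp P) => [//|m [|m' r] IHr] hr _.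
  by rewrite big_seq1; apply: hterm; apply: hr; rewrite mem_head.
rewrite big_cons; apply: positiveD.
  by apply: hterm; apply: hr; rewrite mem_head.
by apply: IHr => // x hx; apply: hr; rewrite inE hx orbT.
Qed.

(* Substitution of a positive map f in a positive function g: write g = P / Q
   with P and Q positive and take P(f) / Q(f).  The denominator never vanishes
   because f is positive, and the result does not depend on the choice of
   (P, Q), see [subst_valE]. *)
Definition subst_val (I J : finType) (f : posmap I J) (g : posfun J) :
    ratfun I :=
  let PQ := xchoose (posvalP g) in eval_poly_at f PQ.1 / eval_poly_at f PQ.2.

Lemma subst_val_positive (I J : finType) (f : posmap I J) (g : posfun J) :
  positive (subst_val f g).
Proof.
rewrite /subst_val; have /and3P[hP hQ _] := xchooseP (posvalP g).
by apply: positiveM; [|apply: positiveV]; apply: positive_eval.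
Qed.

Lemma eval_poly_atM (I J : finType) (f : posmap I J) P Q :
  eval_poly_at f (P * Q) = eval_poly_at f P * eval_poly_at f Q.
Proof. exact: (rmorphM (mmap (intmul 1) _)). Qed.

Lemma subst_valE (I J : finType) (f : posmap I J) (g : posfun J) P Q :
  pos_quot g (P, Q) -> subst_val f g = eval_poly_at f P / eval_poly_at f Q.
Proof.
move=> /and3P[/= hP hQ /eqP gE]; rewrite /subst_val.
have /and3P[hR hS /eqP gE'] := xchooseP (posvalP g).
move: (xchoose _).1 (xchoose _).2 hR hS gE' => R S hR hS gE'.
have nz T : pos_poly T -> FracField.tofrac T != 0 :> ratfun J.
  by case/andP=> T0 _; rewrite tofrac_eq0.
have ez T (hT : pos_poly T) : eval_poly_at f T != 0.
  exact/positive_neq0/positive_eval.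
move/eqP: gE'; rewrite gE eqr_div ?nz // -!tofracM tofrac_eq => /eqP PS.
apply/eqP; rewrite eqr_div ?ez // -!eval_poly_atM; apply/eqP.
by rewrite -PS mulrC.
Qed.

Definition pm_comp (I J K : finType) (g : posmap J K) (f : posmap I J) :
    posmap I K :=
  fun k => PosFun (subst_val_positive f (g k)).

Notation "g \opm f" := (pm_comp g f) (at level 50, left associativity).

Record seed := Seed {
  idx : finType;
  frozen : {set idx};
  eps : idx -> idx -> rat;
  mult : idx -> nat;
  eps_int : forall i j,
    ~~ ((i \in frozen) && (j \in frozen)) -> eps i j \is a Num.int;
  mult_gt0 : forall i, (0 < mult i)%N;
  mult_gcd : \big[gcdn/0%N]_(i : idx) mult i = 1%N;
  eps_skew : forall i j,
    eps i j * (mult j)%:R^-1 = - (eps j i * (mult i)%:R^-1)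
}.

Section Mutation.
Variables (s : seed) (k : idx s).

Definition mut_eps (i j : idx s) : rat :=
  if (i == k) || (j == k) then - eps i j
  else if eps i k * eps k j <= 0 then eps i j
  else eps i j + `|eps i k| * eps k j.

Hypothesis k_mut : k \notin frozen s.

Lemma eps_col_int i : eps i k \is a Num.int.
Proof. by apply: eps_int; rewrite (negbTE k_mut) andbF. Qed.

Lemma eps_row_int j : eps k j \is a Num.int.
Proof. by apply: eps_int; rewrite (negbTE k_mut). Qed.

Lemma mut_eps_int_iff i j :
  (mut_eps i j \is a Num.int) = (eps i j \is a Num.int).
Proof.
rewrite /mut_eps; case: ifP => _; first by rewrite rpredN.
case: ifP => _ //; rewrite rpredDr // rpredM ?eps_row_int //.
by have /intrP[m ->] := eps_col_int i; rewrite -intr_norm intr_int.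
Qed.

Lemma mut_eps_int i j :
  ~~ ((i \in frozen s) && (j \in frozen s)) -> mut_eps i j \is a Num.int.
Proof. by move=> /eps_int; rewrite mut_eps_int_iff. Qed.

Lemma mut_eps_skew i j :
  mut_eps i j * (mult j)%:R^-1 = - (mut_eps j i * (mult i)%:R^-1).
Proof.
pose u (a b : idx s) := eps a b * (mult b)%:R^-1 : rat.
have dgt (a : idx s) : 0 < (mult a)%:R :> rat by rewrite ltr0n mult_gt0.
have uE (a b : idx s) : eps a b = u a b * (mult b)%:R by rewrite divfK // gt_eqF.
have uS (a b : idx s) : u a b = - u b a by exact: eps_skew.
have posE a b : (eps a k * eps k b <= 0) = (u a k * u k b <= 0).
  by rewrite !uE mulrACA pmulr_lle0 // mulr_gt0.
have normE a b : `|eps a k| * eps k b * (mult b)%:R^-1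
    = (mult k)%:R * (`|u a k| * u k b).
  rewrite !uE normrM (gtr0_norm (dgt k)) [X in X / _]mulrA mulfK ?gt_eqF //.
  by rewrite mulrAC mulrC.
have absE (x y : rat) : 0 < x * y -> `|x| * y = x * `|y|.
  move=> xy0; have [x0|x0|x0] := ltrgt0P x; last by rewrite x0 mul0r in xy0.
  - by rewrite (@gtr0_norm _ y) // -(pmulr_rgt0 _ x0).
  - by rewrite (@ltr0_norm _ y) ?mulrN ?mulNr // -(nmulr_rgt0 _ x0).
rewrite /mut_eps orbC; case: ifP => _; first by rewrite !mulNr eps_skew.
rewrite !posE (uS j k) (uS k i) mulrNN [u k j * _]mulrC.
case: ifPn => [_|]; first exact: eps_skew.
rewrite -ltNge => /absE E.
rewrite !mulrDl opprD eps_skew !normE; congr (_ + _).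
by rewrite E (uS k i) (uS j k) normrN mulrN mulrN opprK [`|_| * _]mulrC.
Qed.

End Mutation.

Definition mutate (s : seed) (k : idx s) (hk : k \notin frozen s) : seed :=
  @Seed (idx s) (frozen s) (mut_eps k) (@mult s)
    (mut_eps_int hk) (@mult_gt0 s) (mult_gcd s) (mut_eps_skew k).

Record seed_iso (s s' : seed) := SeedIso {
  iso_fun : idx s -> idx s';
  iso_inv : idx s' -> idx s;
  iso_funK : cancel iso_fun iso_inv;
  iso_invK : cancel iso_inv iso_fun;
  iso_frozen : forall i, (iso_fun i \in frozen s') = (i \in frozen s);
  iso_eps : forall i j, eps (iso_fun i) (iso_fun j) = eps i j;
  iso_mult : forall i, mult (iso_fun i) = mult i
}.

(* Identities are isomorphisms, and mutations and isomorphisms are invertible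
   up to these generators, so no further constructors are needed. *)
Inductive cluster_transf : seed -> seed -> Type :=
| CTmut (s : seed) (k : idx s) (hk : k \notin frozen s) :
    cluster_transf s (mutate hk)
| CTiso (s s' : seed) (sigma : seed_iso s s') : cluster_transf s s'
| CTcomp (s s' s'' : seed) :
    cluster_transf s s' -> cluster_transf s' s'' -> cluster_transf s s''.

Definition equivalent (s s' : seed) : Prop := inhabited (cluster_transf s s').

(* For an integral rational q, [numq q] is q itself as an integer. *)

Definition mutX_val (s : seed) (k i : idx s) : ratfun (idx s) :=
  if i == k then (coord k)^-1
  else coord i * (1 + coord k ^ (- sgz (eps i k))) ^ (- numq (eps i k)).

Definition mutA_val (s : seed) (k i : idx s) : ratfun (idx s) :=
  if i == k then
    (\prod_(j | 0 < eps k j) coord j ^ numq (eps k j)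
     + \prod_(j | eps k j < 0) coord j ^ (- numq (eps k j))) / coord k
  else coord i.

Definition p_val (s : seed) (i : idx s) : ratfun (idx s) :=
  \prod_(j : idx s) coord j ^ numq (eps i j).

Lemma mutX_positive (s : seed) (k i : idx s) : positive (mutX_val k i).
Proof.
rewrite /mutX_val; case: ifP => _.
  exact: positiveV (positive_coord _).
apply: positiveM (positive_coord _) _.
exact: positiveXz (positiveD (positive1 _) (positiveXz _ (positive_coord _))).
Qed.

Lemma mutA_positive (s : seed) (k i : idx s) : positive (mutA_val k i).
Proof.
rewrite /mutA_val; case: ifP => _; last exact: positive_coord.
apply: positiveM; last exact: positiveV (positive_coord _).
by apply: positiveD; apply: positive_prod => j;
  exact: positiveXz (positive_coord _).
Qed.

Lemma p_positive (s : seed) (i : idx s) : positive (p_val i).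
Proof. by apply: positive_prod => j; exact: positiveXz (positive_coord _). Qed.

Definition mutX (s : seed) (k : idx s) : posmap (idx s) (idx s) :=
  fun i => PosFun (mutX_positive k i).

Definition mutA (s : seed) (k : idx s) : posmap (idx s) (idx s) :=
  fun i => PosFun (mutA_positive k i).

Definition isoT (s s' : seed) (sigma : seed_iso s s') :
    posmap (idx s) (idx s') :=
  fun i' => PosFun (positive_coord (iso_inv sigma i')).

Fixpoint ctX (s s' : seed) (c : cluster_transf s s') :
    posmap (idx s) (idx s') :=
  match c in cluster_transf s1 s2 return posmap (idx s1) (idx s2) with
  | CTmut _ k _ => mutX k
  | CTiso _ _ sigma => isoT sigma
  | CTcomp _ _ _ c1 c2 => ctX c2 \opm ctX c1
  end.

Fixpoint ctA (s s' : seed) (c : cluster_transf s s') :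
    posmap (idx s) (idx s') :=
  match c in cluster_transf s1 s2 return posmap (idx s1) (idx s2) with
  | CTmut _ k _ => mutA k
  | CTiso _ _ sigma => isoT sigma
  | CTcomp _ _ _ c1 c2 => ctA c2 \opm ctA c1
  end.

(* [p_map s] is the homomorphism p of the seed tori; it makes sense as such
   when all the exponents eps i j, including those with i and j both frozen,
   are integers. *)
Definition p_map (s : seed) : posmap (idx s) (idx s) :=
  fun i => PosFun (p_positive i).

Definition integral_seed (s : seed) : Prop :=
  forall i j : idx s, eps i j \is a Num.int.

Lemma cluster_transf_integral (s s' : seed) :
  cluster_transf s s' -> integral_seed s -> integral_seed s'.
Proof.
elim=> {s s'} [s k hk|s s' sigma|s s' s'' _ IH1 _ IH2] hs.
- by move=> i j; rewrite /= mut_eps_int_iff.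
- move=> i j; rewrite -(iso_invK sigma i) -(iso_invK sigma j) iso_eps.
  exact: hs.
- exact: IH2 (IH1 hs).
Qed.

(* A map of positive spaces A -> X over the identity, i.e. a natural
   transformation, on the seeds equivalent to s0.  Naturality with respect to
   cluster transformations is the same as naturality with respect to their
   classes modulo those acting trivially on the tori. *)
Definition positive_space_map (s0 : seed)
    (q : forall s : seed, posmap (idx s) (idx s)) : Prop :=
  forall s s' : seed, equivalent s0 s -> equivalent s0 s' ->
  forall c : cluster_transf s s', q s' \opm ctA c =pm ctX c \opm q s.

(* When some exponents eps i j with i, j frozen are not integral, p is only
   defined after extraction of roots.  For a positive map a from a torus T to
   the A-torus of s, [p_lift a x] says that x is the point
   X_i = \prod_j a_j ^ (eps i j) of the X-torus, the fractional powers being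
   positive roots: each M-th power of X_i with M clearing the denominators of
   row i is the corresponding monomial.  Such an x is unique, as positive
   functions have at most one positive M-th root.  If s is integral then
   p_lift a x means x = p \o a; in general it is satisfied by the evident
   monomials x for the covering a_j = (coord j) ^ N with N large. *)
Definition p_lift (T : finType) (s : seed) (a x : posmap T (idx s)) : Prop :=
  forall (i : idx s) (M : nat), (0 < M)%N ->
  (forall j : idx s, M%:R * eps i j \is a Num.int) ->
  posval (x i) ^+ M = \prod_(j : idx s) posval (a j) ^ numq (M%:R * eps i j).

(* Main.v *)
From mathcomp Require Import all_boot all_order all_algebra.
From mathcomp.multinomials Require Import mpoly.
Require Import Defs.

(** Both statements reduce to one computation with points.  A pair (a, x) of
    points of the A- and X-tori of a seed with values in a torus T is
    p-related when x_i is the monomial of exponents (eps i j)_j in the a_j,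
    fractional powers being read off on M-th powers ([p_lift]).  Cluster
    transformations preserve p-related pairs ([p_lift_transf]).  For a seed
    isomorphism this is a reindexing.  For a mutation at k, write P+ and P- for
    the two monomials of the exchange relation and S = P+ + P-.  As row k is
    integral, x_k = P+ / P-, hence 1 + x_k ^ (- sgn e) = S / P_e where
    e = eps i k and P_e is P+ or P- according to the sign of e
    ([mutX_powE]).  So x_i is multiplied by P_e ^ e * S ^ (- e).  On the other
    side eps' i j = eps i j + e |eps k j| when eps k j has the sign of e, and
    these additional exponents produce P_e ^ e, while replacing a_k by S / a_k
    with the exponent - e of the mutated seed produces S ^ (- e) and keeps
    a_k ^ e ([prod_exchange]).  All exponents are multiplied by the same M
    before and after the mutation, so no root is ever extracted.

    For compositions one needs that composition of positive maps is
    associative ([pm_compA]), although it is defined through chosen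
    representatives P / Q.  This is handled by the relation [specializes]: it
    is the graph of the extension of a ring morphism from a domain to the local
    ring at its kernel, so it is functional and compatible with the field
    operations, and the value of any explicit expression follows from the
    values of its coordinates.

    The first part is the second one for the universal point: when eps is
    integral, the identity of the A-torus and p form a p-related pair
    ([p_lift_p_map]), and a p-related pair (a, x) satisfies x = p o a
    ([p_lift_integral]). *)

Set Implicit Arguments.
Unset Strict Implicit.
Unset Printing Implicit Defensive.

Import Order.TTheory GRing.Theory Num.Theory.
Local Open Scope ring_scope.

(** * Substitution as the specialization of a fraction *)

Section Specialization.
Variables (A : idomainType) (F : fieldType) (phi : {rmorphism A -> F}).
Implicit Types (P Q R S : A) (g : {fraction A}) (h : F).

(** Stated as a relation because a morphism phi with a kernel does not extend to
    the whole fraction field: g has a value only when some denominator of g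
    survives phi. *)
Definition specializes g h : Prop :=
  exists P Q,
    [/\ phi Q != 0, g = FracField.tofrac P / FracField.tofrac Q &
        h = phi P / phi Q].

Let phi_neq0 Q : phi Q != 0 -> FracField.tofrac Q != 0.
Proof. by rewrite tofrac_eq0; apply: contraNneq => ->; rewrite rmorph0. Qed.

Lemma specializes_tofrac P : specializes (FracField.tofrac P) (phi P).
Proof. by exists P, 1; rewrite rmorph1 oner_neq0 tofrac1 !divr1. Qed.

Lemma specializes0 : specializes 0 0.
Proof. by have := specializes_tofrac 0; rewrite tofrac0 rmorph0. Qed.

Lemma specializes1 : specializes 1 1.
Proof. by have := specializes_tofrac 1; rewrite tofrac1 rmorph1. Qed.

Lemma specializes_int (z : int) : specializes z%:~R z%:~R.
Proof. by have := specializes_tofrac z%:~R; rewrite !rmorph_int. Qed.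

Lemma specializesD g g' h h' :
  specializes g h -> specializes g' h' -> specializes (g + g') (h + h').
Proof.
move=> [P [Q [Q0 -> ->]]] [R [S [S0 -> ->]]].
exists (P * S + R * Q), (Q * S).
by rewrite !rmorphD !rmorphM mulf_neq0 // !addf_div ?phi_neq0.
Qed.

Lemma specializesM g g' h h' :
  specializes g h -> specializes g' h' -> specializes (g * g') (h * h').
Proof.
move=> [P [Q [Q0 -> ->]]] [R [S [S0 -> ->]]].
by exists (P * R), (Q * S); rewrite !rmorphM mulf_neq0 // !mulf_div.
Qed.

Lemma specializesV g h : h != 0 -> specializes g h -> specializes g^-1 h^-1.
Proof.
move=> h0 [P [Q [Q0 -> hE]]]; exists Q, P; rewrite hE !invf_div; split=> //.
by apply: contraNneq h0 => P0; rewrite hE P0 mul0r.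
Qed.

Lemma specializesXn g h n :
  specializes g h -> specializes (g ^+ n) (h ^+ n).
Proof.
move=> gh; elim: n => [|n IHn]; first exact: specializes1.
by rewrite !exprS; apply: specializesM.
Qed.

Lemma specializesXz g h (z : int) : h != 0 ->
  specializes g h -> specializes (g ^ z) (h ^ z).
Proof.
move=> h0 gh; case: z => n; first exact: specializesXn.
by apply: specializesV; [rewrite expf_neq0 | apply: specializesXn].
Qed.

Lemma specializes_sum (K : Type) (r : seq K) (p : pred K) G H :
  (forall i, specializes (G i) (H i)) ->
  specializes (\sum_(i <- r | p i) G i) (\sum_(i <- r | p i) H i).
Proof.
move=> GH; apply: (big_ind2 specializes) => //; first exact: specializes0.
by move=> *; apply: specializesD.
Qed.

Lemma specializes_prod (K : Type) (r : seq K) (p : pred K) G H :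
  (forall i, specializes (G i) (H i)) ->
  specializes (\prod_(i <- r | p i) G i) (\prod_(i <- r | p i) H i).
Proof.
move=> GH; apply: (big_ind2 specializes) => //; first exact: specializes1.
by move=> *; apply: specializesM.
Qed.

(** P / Q = R / S means P * S = R * Q in the domain, an equality that phi
    preserves: the value does not depend on the representative. *)
Lemma specializes_fun g h h' : specializes g h -> specializes g h' -> h = h'.
Proof.
move=> [P [Q [Q0 -> ->]]] [R [S [S0 + ->]]].
move/eqP; rewrite eqr_div ?phi_neq0 // -!tofracM tofrac_eq => /eqP PS.
by apply/eqP; rewrite eqr_div // -!rmorphM PS.
Qed.

End Specialization.

(** [eval_poly_at f] with its structure of ring morphism. *)
Definition eval_at (I J : finType) (f : posmap I J) :
    {rmorphism {mpoly int[#|J|]} -> ratfun I} :=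
  mmap (intmul 1) (fun r => posval (f (enum_val r))).

Section Substitution.
Variables (I J : finType) (f : posmap I J).

Lemma specializes_coord j : specializes (eval_at f) (coord j) (posval (f j)).
Proof.
have -> : posval (f j) = eval_at f 'X_(enum_rank j).
  by rewrite /eval_at /= mmapX mmap1U enum_rankK.
exact: specializes_tofrac.
Qed.

Lemma specializes_subst (g : posfun J) :
  specializes (eval_at f) (posval g) (subst_val f g).
Proof.
have [[P Q] gPQ] := posvalP g; rewrite (subst_valE f gPQ).
have /and3P[/= _ posQ /eqP gE] := gPQ.
exists P, Q; split; [|exact: gE|exact: erefl].
exact: (positive_neq0 (positive_eval f posQ)).
Qed.

(** The tool by which substitutions are computed: a value of g obtained by the
    closure properties of [specializes] is the value on the chosen
    representative. *)
Lemma subst_val_specializes (g : posfun J) h :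
  specializes (eval_at f) (posval g) h -> subst_val f g = h.
Proof. exact: specializes_fun (specializes_subst g). Qed.

End Substitution.

Lemma posval_neq0 (I : finType) (f : posfun I) : posval f != 0.
Proof. exact/positive_neq0/posvalP. Qed.

(** Evaluating a polynomial at g and then specializing at f amounts to
    evaluating it at g o f, because both are sums of products of values of
    coordinates; apply this to a numerator and a denominator of each h_l. *)
Lemma pm_compA (I J K L : finType) (h : posmap K L) (g : posmap J K)
    (f : posmap I J) : (h \opm g) \opm f =pm h \opm (g \opm f).
Proof.
move=> l; apply/subst_val_specializes => /=.
have evalE P : specializes (eval_at f) (eval_at g P) (eval_at (g \opm f) P).
  rewrite /eval_at /= /mmap; apply: specializes_sum => m.
  apply: specializesM; first exact: specializes_int.
  apply: specializes_prod => r; apply: specializesXn.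
  exact: specializes_subst.
have [[P Q] hPQ] := posvalP (h l).
rewrite (subst_valE g hPQ) (subst_valE (g \opm f) hPQ).
have /and3P[_ /= posQ _] := hPQ.
apply: specializesM; first exact: evalE.
apply: specializesV; last exact: evalE.
exact: (positive_neq0 (positive_eval _ posQ)).
Qed.

Definition pm_id (I : finType) : posmap I I :=
  fun i => PosFun (positive_coord i).

Lemma pm_comp1 (I J : finType) (g : posmap I J) : g \opm @pm_id I =pm g.
Proof.
move=> j; have evalE P : eval_poly_at (@pm_id I) P = FracField.tofrac P.
  rewrite [in RHS](mpolyE P) (rmorph_sum (@FracField.tofrac _)).
  rewrite /eval_poly_at /mmap; apply: eq_bigr => m _.
  rewrite -mul_mpolyC (rmorphM (@FracField.tofrac _)); congr (_ * _).
    rewrite -[X in X%:MP]intz.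
    rewrite (rmorph_int (@mpolyC #|I| _)).
    exact: (esym (rmorph_int (@FracField.tofrac _) _)).
  rewrite mpolyXE_id (rmorph_prod (@FracField.tofrac _)); apply: eq_bigr => r _.
  by rewrite (rmorphXn (@FracField.tofrac _)) /= /coord enum_valK.
have [[P Q] gPQ] := posvalP (g j).
by rewrite /= (subst_valE _ gPQ) !evalE; case/and3P: gPQ => _ _ /eqP.
Qed.

(** * Isomorphisms of seeds *)

Lemma p_lift_ext (T : finType) (s : seed) (a a' x x' : posmap T (idx s)) :
  a =pm a' -> x =pm x' -> p_lift a x -> p_lift a' x'.
Proof.
move=> aE xE ax i M M0 Mint; rewrite -(xE i) (ax i M M0 Mint).
by apply: eq_bigr => j _; rewrite (aE j).
Qed.

Lemma p_lift_iso (s s' : seed) (sigma : seed_iso s s') (T : finType)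
    (a x : posmap T (idx s)) :
  p_lift a x -> p_lift (isoT sigma \opm a) (isoT sigma \opm x).
Proof.
have isoE (b : posmap T (idx s)) i' :
    posval ((isoT sigma \opm b) i') = posval (b (iso_inv sigma i')).
  exact/subst_val_specializes/specializes_coord.
move=> ax i' M M0 Mint; rewrite isoE.
have epsE j : eps (iso_inv sigma i') j = eps i' (iso_fun sigma j).
  by rewrite -(iso_eps sigma) iso_invK.
rewrite ax //; last by move=> j; rewrite epsE.
rewrite [RHS](reindex (iso_fun sigma)); last first.
  by exists (iso_inv sigma) => j _; rewrite ?iso_funK ?iso_invK.
by apply: eq_bigr => j _; rewrite isoE iso_funK epsE.
Qed.

(** * The exchange computation *)

Lemma numqD_int (x y : rat) : x \is a Num.int -> y \is a Num.int ->
  numq (x + y) = numq x + numq y.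
Proof. by move=> /intrP[m ->] /intrP[n ->]; rewrite -intrD !numq_int. Qed.

Lemma numqM_int (x y : rat) : x \is a Num.int -> y \is a Num.int ->
  numq (x * y) = numq x * numq y.
Proof. by move=> /intrP[m ->] /intrP[n ->]; rewrite -intrM !numq_int. Qed.

(** Since 1 + p / q = (p + q) / q and 1 + q / p = (p + q) / p, the sign of e
    selects which of p and q is the denominator. *)
Lemma addr1_sgz_pow (F : fieldType) (p q : F) (e : rat) :
  p != 0 -> q != 0 -> e != 0 ->
  (1 + (p / q) ^ (- sgz e)) ^ (- numq e)
  = (if 0 < e then p else q) ^ numq e * (p + q) ^ (- numq e).
Proof.
move=> p0 q0 e0.
have -> : 1 + (p / q) ^ (- sgz e) = (p + q) / (if 0 < e then p else q).
  rewrite mulrDl; case: (ltrgt0P e) e0 => [epos|eneg|->] // _.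
  - by rewrite gtr0_sgz // divff // -invr_expz expr1z invf_div.
  - by rewrite ltr0_sgz // opprK expr1z divff // addrC.
by rewrite expfzMl mulrC exprz_inv opprK.
Qed.

(** The effect on monomials of an exchange b'_k = y / b_k: opposite exponents of
    b_k and b'_k cancel up to y ^ (- u_k), and the increments u_k * w_j of the
    other exponents collect into a u_k-th power. *)
Lemma prod_exchange (F : fieldType) (K : finType) (k : K) (b b' : K -> F)
    (u v w : K -> int) (y : F) :
  (forall j, b j != 0) ->
  b' k = y / b k -> (forall j, j != k -> b' j = b j) ->
  v k = - u k -> (forall j, j != k -> v j = u j + u k * w j) ->
  (\prod_j b j ^ u j)
    * ((\prod_(j | j != k) b j ^ w j) ^ u k * y ^ (- u k))
  = \prod_j b' j ^ v j.
Proof.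
move=> b0 b'k b'E vk vE; rewrite (bigD1 k) //= [in RHS](bigD1 k) //= b'k vk.
have -> : \prod_(j | j != k) b' j ^ v j = (\prod_(j | j != k) b j ^ u j)
    * (\prod_(j | j != k) b j ^ w j) ^ u k.
  rewrite (big_morph (fun z => z ^ u k) (fun z t => expfzMl z t _) (exp1rz _ _)).
  rewrite -big_split; apply: eq_bigr => j jk /=.
  by rewrite b'E // vE // expfzDr // exprz_exp [w j * _]mulrC.
rewrite expfzMl exprz_inv opprK [RHS]mulrAC -!mulrA mulrC -!mulrA.
by rewrite [RHS]mulrC -!mulrA; congr (_ * (_ * _)); rewrite mulrC.
Qed.

Lemma eps_diag (s : seed) (k : idx s) : eps k k = 0.
Proof.
have /eqP := eps_skew k k; rewrite -addr_eq0 -mulr2n mulrn_eq0 /= mulf_eq0.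
by rewrite invr_eq0 pnatr_eq0 eqn0Ngt mult_gt0 orbF => /eqP.
Qed.

(** When eps i k and eps k j have the same sign, |eps i k| * eps k j equals
    eps i k * |eps k j|; with the absolute value on this side the correction is
    a multiple, by eps i k, of exponents that depend on i through the sign of
    eps i k only. *)
Lemma mut_eps_sum (s : seed) (k i j : idx s) : i != k -> j != k ->
  mut_eps k i j
  = eps i j + eps i k * (if 0 < eps i k * eps k j then `|eps k j| else 0).
Proof.
move=> ik jk; rewrite /mut_eps (negbTE ik) (negbTE jk) /= ltNge.
case: ifP => [_|/negbT]; first by rewrite mulr0 addr0.
rewrite -ltNge => xy; congr (_ + _).
have [x0|x0|x0] := ltrgt0P (eps i k); last by rewrite x0 mul0r ltxx in xy.
- by rewrite gtr0_norm // -(pmulr_rgt0 _ x0).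
- by rewrite ltr0_norm ?mulrN ?mulNr // -(nmulr_rgt0 _ x0).
Qed.

Section MutationOfPoints.
Variables (s : seed) (k : idx s) (hk : k \notin frozen s).
Variables (T : finType) (a x : posmap T (idx s)).

Definition mono_pos : ratfun T :=
  \prod_(j | 0 < eps k j) posval (a j) ^ numq (eps k j).

Definition mono_neg : ratfun T :=
  \prod_(j | eps k j < 0) posval (a j) ^ (- numq (eps k j)).

Lemma mono_pos_positive : positive mono_pos.
Proof. by apply: positive_prod => j; apply/positiveXz/posvalP. Qed.

Lemma mono_neg_positive : positive mono_neg.
Proof. by apply: positive_prod => j; apply/positiveXz/posvalP. Qed.

Lemma mutA_pointE i : posval ((mutA k \opm a) i) =
  if i == k then (mono_pos + mono_neg) / posval (a k) else posval (a i).
Proof.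
apply: subst_val_specializes; rewrite /= /mutA_val.
have spc j z : specializes (eval_at a) (coord j ^ z) (posval (a j) ^ z).
  by apply: specializesXz (specializes_coord a j); apply: posval_neq0.
case: ifP => _; last exact: specializes_coord.
apply: specializesM.
  by apply: specializesD; apply: specializes_prod.
by apply: specializesV (specializes_coord a k); apply: posval_neq0.
Qed.

Lemma mutX_pointE i : posval ((mutX k \opm x) i) =
  if i == k then (posval (x k))^-1 else
  posval (x i) * (1 + posval (x k) ^ (- sgz (eps i k))) ^ (- numq (eps i k)).
Proof.
apply: subst_val_specializes; rewrite /= /mutX_val.
have spc := specializes_coord x.
case: ifP => _; first by apply: specializesV; rewrite ?posval_neq0.
apply: specializesM => //; apply: specializesXz.
  apply: positive_neq0; apply: positiveD; first exact: positive1.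
  exact/positiveXz/posvalP.
apply: specializesD; first exact: specializes1.
by apply: specializesXz; rewrite ?posval_neq0.
Qed.

(** The exchange monomial selected by the sign of e, that is, the product over
    the j for which the mutation rule corrects the exponent. *)
Definition mono_agree (e : rat) : ratfun T :=
  \prod_(j | 0 < e * eps k j) posval (a j) ^ numq `|eps k j|.

Lemma mono_agreeE (e : rat) :
  e != 0 -> mono_agree e = if 0 < e then mono_pos else mono_neg.
Proof.
rewrite /mono_agree => e0; case: ifP => [epos|/negbT].
  apply: eq_big => [j|j]; first by rewrite pmulr_rgt0.
  by rewrite pmulr_rgt0 // => /gtr0_norm ->.
rewrite -leNgt le_eqVlt (negbTE e0) /= => eneg.
apply: eq_big => [j|j]; first by rewrite nmulr_rgt0.
by rewrite nmulr_rgt0 // => /ltr0_norm ->; rewrite numqN.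
Qed.

Hypothesis ax : p_lift a x.

(** Row k is integral because k is mutable, so M = 1 is allowed there even when
    p itself is multivalued. *)
Lemma p_lift_row_mut : posval (x k) = mono_pos / mono_neg.
Proof.
have := ax (isT : (0 < 1)%N) (i := k); rewrite expr1 => -> => [|j]; last first.
  by rewrite mul1r eps_row_int.
rewrite (bigID (fun j => 0 < eps k j)) /=; congr (_ * _).
  by apply: eq_bigr => j _; rewrite mul1r.
rewrite -prodfV (bigID (fun j => eps k j < 0)) /= [X in _ * X]big1 ?mulr1.
  apply: eq_big => [j|j _]; last by rewrite mul1r invr_expz opprK.
  by case: ltgtP.
move=> j; rewrite -!leNgt -eq_le => /eqP ->.
by rewrite mulr0 expr0z.
Qed.

Lemma mutX_powE (e : rat) :
  (1 + posval (x k) ^ (- sgz e)) ^ (- numq e)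
  = mono_agree e ^ numq e * (mono_pos + mono_neg) ^ (- numq e).
Proof.
(* For e = 0 both sides are 0-th powers. *)
have [->|e0] := eqVneq e 0; first by rewrite oppr0 !expr0z mulr1.
rewrite p_lift_row_mut mono_agreeE // addr1_sgz_pow //.
- exact: positive_neq0 mono_pos_positive.
- exact: positive_neq0 mono_neg_positive.
Qed.

Lemma p_lift_mut : p_lift (s := mutate hk) (mutA k \opm a) (mutX k \opm x).
Proof.
suff monE (i : idx s) M : (0 < M)%N ->
    (forall j, M%:R * mut_eps k i j \is a Num.int) ->
    posval ((mutX k \opm x) i) ^+ M
    = \prod_j posval ((mutA k \opm a) j) ^ numq (M%:R * mut_eps k i j).
  by move=> i M; apply: monE.
move=> M0 Mint; rewrite mutX_pointE.
have Mr : M%:R \is a @Num.int rat by rewrite natr_int.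
have rowint j : eps k j \is a Num.int := eps_row_int hk j.
have colint : eps i k \is a Num.int := eps_col_int hk i.
have a0 j : posval (a j) != 0 := posval_neq0 (a j).
have [->|ik] := eqVneq i k.
  (* Row k changes sign; its entry at k is 0, so a_k does not occur. *)
  have := ax (isT : (0 < 1)%N) (i := k); rewrite expr1 => -> => [|j]; last first.
    by rewrite mul1r.
  rewrite -prodfV -prodrXl; apply: eq_bigr => j _.
  rewrite mutA_pointE /mut_eps eqxx /= mul1r mulrN numqN.
  rewrite numqM_int // -[M%:R]/(M%:~R) numq_int.
  case: (eqVneq j k) => [->|_].
    by rewrite eps_diag mulr0 oppr0 !expr0z invr1 expr1n.
  by rewrite invr_expz exprnP exprz_exp mulNr mulrC.
(* From here on [M%:R * eps i k] and the [d j] are integers, so that every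
   exponent is an honest integer and numq is additive on them. *)
pose d j : rat := if 0 < eps i k * eps k j then `|eps k j| else 0.
have dint j : d j \is a Num.int.
  rewrite /d; case: ifP => // _.
  by have /intrP[m ->] := rowint j; rewrite -intr_norm.
have mutE j : j != k -> M%:R * mut_eps k i j
    = M%:R * eps i j + (M%:R * eps i k) * d j.
  by move=> jk; rewrite mut_eps_sum // mulrDr mulrA.
(* The correction of the exponents by the mutation is integral, so the M that
   clears the denominators of the mutated row clears those of the row of s. *)
have epsint j : M%:R * eps i j \is a Num.int.
  have [->|jk] := eqVneq j k; first exact: rpredM.
  rewrite -(rpredDr _ (rpredM (rpredM Mr colint) (dint j))) -mutE //; exact: Mint.
have agreeE : mono_agree (eps i k)
    = \prod_(j | j != k) posval (a j) ^ numq (d j).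
  rewrite /mono_agree big_mkcond [RHS]big_mkcond; apply: eq_bigr => j _ /=.
  rewrite /d; case: (eqVneq j k) => [->|_]; first by rewrite eps_diag mulr0 ltxx.
  by case: ifP.
set n := numq (M%:R * eps i k).
have nE : numq (eps i k) * M = n.
  by rewrite /n numqM_int // -[M%:R]/(M%:~R) numq_int mulrC.
rewrite mutX_powE exprMn (ax M0) //.
rewrite exprnP expfzMl !exprz_exp mulNr nE agreeE.
apply: prod_exchange => //.
- by rewrite mutA_pointE eqxx.
- by move=> j jk; rewrite mutA_pointE (negbTE jk).
- by rewrite /mut_eps eqxx orbT mulrN numqN.
- move=> j jk; rewrite mutE //.
  rewrite (numqD_int (epsint j) (rpredM (rpredM Mr colint) (dint j))).
  by rewrite (numqM_int (rpredM Mr colint)).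
Qed.

End MutationOfPoints.

(** * Cluster transformations *)

Lemma p_lift_transf (s s' : seed) (c : cluster_transf s s') (T : finType)
    (a x : posmap T (idx s)) :
  p_lift a x -> p_lift (ctA c \opm a) (ctX c \opm x).
Proof.
elim: c a x => {s s'} [s k hk|s s' sigma|s s' s'' c1 IH1 c2 IH2] a x ax.
- exact: p_lift_mut.
- exact: p_lift_iso.
- apply: p_lift_ext (IH2 _ _ (IH1 _ _ ax)) => i; exact/esym/pm_compA.
Qed.

(** The universal p-related pair: the tautological point of the A-torus and its
    image by p. *)
Lemma p_lift_p_map (s : seed) :
  integral_seed s -> p_lift (@pm_id (idx s)) (@p_map s).
Proof.
move=> sint i M _ _ /=; rewrite /p_val -prodrXl; apply: eq_bigr => j _.
rewrite exprnP exprz_exp numqM_int ?natr_int //.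
by rewrite -[M%:R]/(M%:~R) numq_int mulrC.
Qed.

Lemma p_lift_integral (T : finType) (s : seed) (a x : posmap T (idx s)) :
  integral_seed s -> p_lift a x -> @p_map s \opm a =pm x.
Proof.
move=> sint ax i; apply/subst_val_specializes.
have := ax i 1%N isT; rewrite expr1 => -> => [|j]; last by rewrite mul1r.
apply: specializes_prod => j; rewrite mul1r.
by apply: specializesXz (specializes_coord a j); apply: posval_neq0.
Qed.

(* First part: p is a map of positive spaces, whenever it is a family of
   homomorphisms of tori, i.e. the exponents eps i j are integers.  Second part:
   the same commutation without this restriction, p being then multivalued
   (fractional powers of frozen coordinates) and applied to the points of the
   A-torus with values in an arbitrary torus T over which the roots exist. *)
Theorem proposition2p2 (s0 : seed) :
  (integral_seed s0 -> positive_space_map s0 p_map) /\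
  (forall (s s' : seed), equivalent s0 s -> equivalent s0 s' ->
   forall (c : cluster_transf s s') (T : finType) (a x : posmap T (idx s)),
     p_lift a x -> p_lift (pm_comp (ctA c) a) (pm_comp (ctX c) x)).
Proof.
split=> [s0int s s' [c0] [c0'] c|s s' _ _ c T a x]; last exact: p_lift_transf.
have sint := cluster_transf_integral c0 s0int.
have s'int := cluster_transf_integral c0' s0int.
apply: p_lift_integral => //.
apply: p_lift_ext (p_lift_transf c (p_lift_p_map sint)) => // i.
exact: pm_comp1.
Qed.
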